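(* Let $R$ be an integrally closed integral domain and let $K$ be its field of fractions. Let $K\subseteq L$ be a finite Galois extension of fields and let $C$ be the integral closure of $R$ in $L$. If $R$ is a D-ring, then $C$ is also a D-ring.
   Context: All rings are commutative with identity. An integral domain $R$ with field of fractions $K$ is called a D-ring if, for all polynomials $f(x),g(x)\in R[x]$ with $g(x)\neq 0$ such that $g(k)\mid f(k)$ in $R$ for almost all $k\in R$ (i.e. for all but finitely many $k\in R$), one has $\frac{f(x)}{g(x)}\in K[x]$, i.e. $g(x)$ divides $f(x)$ in $K[x]$. An integral domain is integrally closed if it equals its integral closure in its field of fractions. *)

(* Defs.v *)
From HB Require Import structures.
From mathcomp Require Import all_boot all_order all_algebra all_field.
From mathcomp Require Import boolp classical_sets cardinality.

Set Implicit Arguments.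
Unset Strict Implicit.
Unset Printing Implicit Defensive.

Import GRing.Theory.
Local Open Scope ring_scope.

Definition rdivides (R : nzRingType) (a b : R) : Prop := exists c : R, b = c * a.

(* K is {fraction R}; g divides f for almost all k, that is, all but finitely many. *)
Definition D_ring (R : idomainType) : Prop :=
  forall f g : {poly R}, g != 0 ->
    finite_set [set k : R | ~ rdivides g.[k] f.[k]]%classic ->
    map_poly (@tofrac R) g %| map_poly (@tofrac R) f.

Definition integrally_closed (R : idomainType) : Prop :=
  forall x : {fraction R},
    integralOver (@tofrac R) x -> exists r : R, x = tofrac r.

(* The subring of the elements of L integral over the image of R. As integralOver *)
(* is a Prop, membership in it is decided classically.                            *)
Section IntegralClosure.

Variables (R : idomainType) (L : fieldType) (RtoL : {rmorphism R -> L}).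

Definition integral_elt : {pred L} := fun x => `[< integralOver RtoL x >].

Lemma integral_eltP x : reflect (integralOver RtoL x) (x \in integral_elt).
Proof. exact: asboolP. Qed.

Fact integral_elt_subring : subring_closed integral_elt.
Proof.
split; first exact/integral_eltP/integral1.
- move=> x y /integral_eltP intx /integral_eltP inty.
  exact/integral_eltP/integral_sub.
- move=> x y /integral_eltP intx /integral_eltP inty.
  exact/integral_eltP/integral_mul.
Qed.

HB.instance Definition _ :=
  GRing.isSubringClosed.Build L integral_elt integral_elt_subring.

Record integral_closure : Type :=
  IntegralElt { integral_val : L; _ : integral_val \in integral_elt }.

HB.instance Definition _ := [isSub for integral_val].
HB.instance Definition _ := [Choice of integral_closure by <:].
HB.instance Definition _ :=
  [SubChoice_isSubComNzRing of integral_closure by <:].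

Definition ic_unit : pred integral_closure :=
  fun x => (val x != 0) && ((val x)^-1 \in integral_elt).

Definition ic_inv (x : integral_closure) : integral_closure :=
  if ic_unit x then insubd x (val x)^-1 else x.

Fact ic_mulVx : {in ic_unit, left_inverse 1 ic_inv *%R}.
Proof.
move=> x x_unit; have ux : ic_unit x := x_unit; apply: val_inj.
have /andP[nz_x int_xV] := ux.
have valV : val (ic_inv x) = (val x)^-1 by rewrite /ic_inv ux insubdK.
by rewrite rmorphM rmorph1 /= valV mulVf.
Qed.

Fact ic_unitP (x y : integral_closure) : y * x = 1 -> ic_unit x.
Proof.
move/(congr1 val) => yx1; have {}yx1 : val y * val x = 1 := yx1.
have nz_x : val x != 0.
  by apply/eqP=> x0; move/eqP: yx1; rewrite x0 mulr0 eq_sym oner_eq0.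
have xVy : (val x)^-1 = val y by rewrite -[LHS]mul1r -yx1 mulfK.
by rewrite /ic_unit nz_x xVy (valP y).
Qed.

Fact ic_inv_out : {in [predC ic_unit], ic_inv =1 id}.
Proof. by move=> x x_nu; rewrite /ic_inv (negPf (x_nu : ~~ ic_unit x)). Qed.

HB.instance Definition _ := GRing.ComNzRing_hasMulInverse.Build integral_closure
  ic_mulVx ic_unitP ic_inv_out.

Fact ic_integral (x y : integral_closure) : x * y = 0 -> (x == 0) || (y == 0).
Proof.
move/(congr1 val) => xy0; have {}xy0 : val x * val y = 0 := xy0.
by move/eqP: xy0; rewrite mulf_eq0.
Qed.

HB.instance Definition _ :=
  GRing.ComUnitRing_isIntegral.Build integral_closure ic_integral.

End IntegralClosure.

Definition frac_ext_embed (R : idomainType) (L : fieldExtType {fraction R}) :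
  {rmorphism R -> L} := in_alg L \o @tofrac R.

(* Main.v *)
Require Import Defs.
From mathcomp Require Import all_boot all_order all_fingroup all_algebra all_field.
From mathcomp Require Import boolp classical_sets cardinality.

(** With [G] the norm of [g] and [F = f * G / g], for every integral [a] the
    polynomial [Tr (a F)] has coefficients in [R] and is divisible by [G] at
    almost all points of [R], hence divisible by [G] as [R] is a D-ring. The
    coefficients of the remainder of [F] modulo [G] are thus orthogonal to all
    integral elements for the trace form, which is nondegenerate: the remainder
    is zero, so that [G] divides [F] and [g] divides [f]. *)

Set Implicit Arguments.
Unset Strict Implicit.
Unset Printing Implicit Defensive.

Import GroupScope GRing.Theory.
Local Open Scope ring_scope.

(** Multiplying together one multiplier per coefficient works because [S] is stable under the image
    of [R]. It serves twice: to clear denominators over [{fraction R}], and to make a polynomial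
    over [L] integral. *)
Lemma common_multiplier (R : idomainType) (F : idomainType)
    (h : {rmorphism R -> F}) (S : F -> Prop) :
    S 0 -> (forall r x, S x -> S (h r * x)) ->
    (forall x, exists2 s, s != 0 & S (h s * x)) ->
  forall p : {poly F}, exists2 s, s != 0 & forall i, S (h s *: p)`_i.
Proof.
move=> S0 SM Sx; elim/poly_ind=> [|p c [s s_nz Sp]].
  by exists 1; rewrite ?oner_eq0 // => i; rewrite scaler0 coef0.
have [t t_nz Sc] := Sx c; exists (t * s); rewrite ?mulf_neq0 // => i.
rewrite coefZ coefD coefMX coefC; case: i => [|i] /=.
  by rewrite add0r rmorphM mulrAC mulrC; apply: SM.
by rewrite addr0 rmorphM -mulrA -coefZ; apply: SM.
Qed.

Lemma poly_image (R S : nzRingType) (h : {rmorphism R -> S}) (p : {poly S}) :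
  (forall i, exists r, p`_i = h r) -> exists q, p = map_poly h q.
Proof.
elim/poly_ind: p => [_|p c IHp hp]; first by exists 0; rewrite map_poly0.
have [q ->]: exists q, p = map_poly h q.
  by apply: IHp => i; have:= hp i.+1; rewrite coefD coefMX coefC /= addr0.
have [r] := hp 0%N; rewrite coefD coefMX coefC /= add0r => ->.
by exists (q * 'X + r%:P); rewrite rmorphD rmorphM /= map_polyX map_polyC.
Qed.

Lemma frac_denominator (R : idomainType) (x : {fraction R}) :
  exists2 s, s != 0 & exists r, tofrac s * x = tofrac r.
Proof.
elim/quotW: x => x; exists (frac x).2; first exact: denom_ratioP.
exists (frac x).1; unlock tofrac.
rewrite -[LHS]FracField.pi_mul; apply/eqmodP.
rewrite /= FracField.equivfE /FracField.mulf.
have d_nz := denom_ratioP x.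
by rewrite !numden_Ratio ?mulf_neq0 ?oner_eq0 // mul1r mulr1.
Qed.

Lemma integral_leading_coef (R : idomainType) (F : fieldType)
    (h : {rmorphism R -> F}) (p : {poly R}) (x : F) :
  root (map_poly h p) x -> integralOver h (h (lead_coef p) * x).
Proof.
case Dn: (size p) => [|[|n]].
(* If [p] is zero or constant, the root forces [h (lead_coef p) = 0], and 0 is integral. *)
- move/eqP: Dn; rewrite size_poly_eq0 => /eqP-> _.
  by rewrite lead_coef0 rmorph0 mul0r; apply: integral0.
- rewrite (size1_polyC (eq_leq Dn)) map_polyC rootC lead_coefC /= => /eqP->.
  by rewrite mul0r; apply: integral0.
set a := lead_coef p; have Da: a = p`_n.+1 by rewrite /a lead_coefE Dn.
rewrite /root /map_poly horner_poly Dn big_ord_recr /= -Da => /eqP px0.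
(* With [p = a X^(n+1) + ...], the monic witness is [a^n p(X / a)]. *)
exists ('X^(n.+1) + \poly_(i < n.+1) (p`_i * a ^+ (n - i))).
  by rewrite monicE lead_coefDl ?lead_coefXn // size_polyXn ltnS size_poly.
apply/eqP; rewrite rmorphD /= map_polyXn hornerD hornerXn.
transitivity (h a ^+ n * 0); last by rewrite mulr0.
rewrite -px0 mulrDr addrC mulr_sumr; congr (_ + _); last first.
  by rewrite exprMn exprS -mulrA mulrCA.
rewrite poly_def rmorph_sum horner_sum; apply: eq_bigr => i _ /=.
rewrite map_polyZ map_polyXn hornerZ hornerXn exprMn /= rmorphM rmorphXn.
have ->: h a ^+ n = h a ^+ (n - i) * h a ^+ i by rewrite -exprD subnK ?leq_ord.
by rewrite -!mulrA mulrCA; congr (_ * _); rewrite mulrCA.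
Qed.

Section GaloisTrace.

Variables (F : fieldType) (L : splittingFieldType F) (U V : {vspace L}).
Local Notation tr := (galTrace U V).

Lemma map_galTraceE p : map_poly tr p = \sum_(x in 'Gal(V / U)) map_poly x p.
Proof.
by apply/polyP=> i; rewrite coef_map coef_sum; apply: eq_bigr => x _; rewrite coef_map.
Qed.

End GaloisTrace.

Section TraceFromTop.

Variables (F : fieldType) (L : splittingFieldType F).
Local Notation tr := (galTrace 1 {:L}).

(** Automorphisms fix the coefficients of [q], so the coefficientwise trace is linear over
    polynomials with base coefficients. This lets divisibility by the norm pass through the
    trace. *)
Lemma map_galTraceM p (q : {poly F}) :
  map_poly tr (p * map_poly (in_alg L) q) = map_poly tr p * map_poly (in_alg L) q.
Proof.
rewrite !map_galTraceE mulr_suml; apply: eq_bigr => x Gx; rewrite rmorphM /=.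
by rewrite (fixedPoly_gal (sub1v _) Gx (alg_polyOver 1%AS _)).
Qed.

Lemma gal_in_alg (x : gal_of {:L}) c : x (in_alg L c) = in_alg L c.
Proof. by rewrite /= linearZ rmorph1. Qed.

Lemma galTraceMr a c : tr (a * in_alg L c) = tr a * in_alg L c.
Proof.
rewrite /galTrace mulr_suml; apply: eq_bigr => x Gx.
by rewrite rmorphM; congr (_ * _); apply: gal_in_alg.
Qed.

Lemma horner_galTrace p c : (map_poly tr p).[in_alg L c] = tr p.[in_alg L c].
Proof.
rewrite map_galTraceE horner_sum; apply: eq_bigr => x Gx.
by rewrite -[in LHS](gal_in_alg x c) horner_map.
Qed.

(** Dedekind's independence of automorphisms, for the combination whose coefficients are all 1. *)
Lemma galTrace_neq0 : exists a, tr a != 0.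
Proof.
have [a _ nz_a] := @gal_independent_contra _ L {:L}
  [in 'Gal({:L} / 1%AS)] (fun=> 1) 1%g (group1 _) (oner_neq0 L).
by exists a; congr (_ != 0): nz_a; apply: eq_bigr => x _; rewrite mul1r.
Qed.

(** Applying an automorphism permutes the factors, so the coefficients of the product lie in the
    fixed field, which is the base field. *)
Lemma poly_norm_over1 (g : {poly L}) : galois 1 {:L} ->
  \prod_(x in 'Gal({:L} / 1)) map_poly x g \is a polyOver 1%VS.
Proof.
move/galois_fixedField=> fix1; apply/polyOverP=> i.
suffices: (\prod_(x in 'Gal({:L} / 1)) map_poly x g)`_i
    \in fixedField 'Gal({:L} / 1%AS) by rewrite fix1.
apply/fixedFieldP=> [|x Gx]; first exact: memvf.
rewrite -coef_map rmorph_prod [in RHS](reindex_acts 'R _ Gx) ?astabsR //=.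
congr (_ : {poly _})`_i; apply: eq_bigr => y _; rewrite -map_poly_comp.
by apply: eq_map_poly => a /=; rewrite galM ?memvf.
Qed.

End TraceFromTop.

Section IntegralClosureInGalois.

Variables (R : idomainType) (L : splittingFieldType {fraction R}).
Local Notation h := (frac_ext_embed L).
Local Notation C := (integral_elt h).
Local Notation tr := (galTrace 1 {:L}).

(** Clearing denominators in the minimal polynomial of [x] gives a polynomial over [R] with root
    [x]; its leading coefficient is the multiplier. *)
Lemma frac_ext_integral_multiple (x : L) :
  exists2 s, s != 0 & h s * x \in C.
Proof.
have /polyOver1P[p Dp] := minPolyOver 1 x.
have [||s s_nz sp] := @common_multiplier R {fraction R} (@tofrac R)
  (fun y => exists r, y = tofrac r) _ _ (@frac_denominator R) p.
- by exists 0; rewrite rmorph0.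
- by move=> r _ [t ->]; exists (r * t); rewrite rmorphM.
have [q Dq] := poly_image sp; exists (lead_coef q).
  (* As [minPoly 1 x] is monic, hence nonzero, [q = 0] would force [s = 0]. *)
  rewrite lead_coef_eq0; apply: contra_neq s_nz => q0; apply/eqP.
  have: in_alg L (tofrac s) *: minPoly 1 x == 0.
    by rewrite Dp -map_polyZ Dq q0 !map_poly0.
  rewrite scaler_eq0 (negPf (monic_neq0 (monic_minPoly _ _))) orbF.
  by rewrite fmorph_eq0 tofrac_eq0.
apply/integral_eltP/integral_leading_coef.
by rewrite map_poly_comp -Dq map_polyZ -Dp rootE hornerZ minPolyxx mulr0.
Qed.

Lemma integral_elt_gal (x : gal_of {:L}) a : a \in C -> x a \in C.
Proof.
move=> /integral_eltP[p mon_p pa0]; apply/integral_eltP; exists p => //.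
have := rmorph_root x pa0; rewrite -map_poly_comp; congr (root _ _).
by apply: eq_map_poly => r; apply: gal_in_alg.
Qed.

Lemma frac_ext_embed_inj : injective h.
Proof. by move=> r s /fmorph_inj/eqP; rewrite tofrac_eq => /eqP. Qed.

Hypothesis R_closed : integrally_closed R.

Lemma integral_in1 a : a \in C -> a \in 1%VS -> exists r, a = h r.
Proof.
move=> /integral_eltP[p mon_p]; rewrite map_poly_comp => pa0 /vlineP[c Da].
move: pa0; rewrite Da fmorph_root => pc0.
by have [|r ->] := R_closed (x := c); [exists p | exists r].
Qed.

Lemma integral_poly_in1 (p : {poly L}) :
  p \is a polyOver C -> p \is a polyOver 1%VS -> exists q, p = map_poly h q.
Proof.
move=> /polyOverP Cp /polyOverP p1; apply: poly_image => i.
exact: integral_in1.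
Qed.

Hypothesis L_galois : galois 1%AS {:L}.

Lemma integral_trace a : a \in C -> exists r, tr a = h r.
Proof.
move=> Ca; apply: integral_in1; last exact: mem_galTrace L_galois (memvf a).
by apply: rpred_sum => x _; apply: integral_elt_gal.
Qed.

Hypothesis R_Dring : D_ring R.

(** Quotients are tested only at points of [R], where the D-ring property of [R] can be applied;
    working in [L[X]] lets the Galois group act directly on coefficients. *)
Lemma dvdp_of_integral_quotients (f g : {poly L}) :
    f \is a polyOver C -> g \is a polyOver C -> g != 0 ->
    finite_set [set k : R | ~ exists2 c, c \in C & f.[h k] = c * g.[h k]]%classic ->
  g %| f.
Proof.
move=> Cf Cg g_nz fin_fg.
pose G := \prod_(x in 'Gal({:L} / 1)) map_poly x g.
(* The product of the other conjugates of [g] stands for [G / g], so that [F] is [f * g']. *)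
pose g' := \prod_(x in 'Gal({:L} / 1) | x != 1%g) map_poly x g.
have DG: G = g * g'.
  rewrite /G (bigD1 1%g) ?group1 //=; congr (_ * _).
  by rewrite (@eq_map_poly _ _ _ id) ?map_poly_id // => a; rewrite gal_id.
have Cmap x : map_poly (x : gal_of {:L}) g \is a polyOver C.
  by apply/polyOverP=> i; rewrite coef_map; apply/integral_elt_gal/(polyOverP Cg).
have Cg' : g' \is a polyOver C by apply: rpred_prod.
have CG : G \is a polyOver C by apply: rpred_prod.
have [G0 DG0] := integral_poly_in1 CG (poly_norm_over1 g L_galois).
have DG1 : G = map_poly (in_alg L) (map_poly (@tofrac R) G0).
  by rewrite DG0 map_poly_comp.
have G_nz : G != 0 by apply/prodf_neq0 => x _; rewrite map_poly_eq0.
have G0_nz : G0 != 0 by apply: contraNneq G_nz => G00; rewrite DG0 G00 map_poly0.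
have g'_nz : g' != 0 by apply: contraNneq G_nz => g'0; rewrite DG g'0 mulr0.
suffices: G %| f * g' by rewrite DG dvdp_mul2r.
set F := f * g'; have CF : F \is a polyOver C by apply: rpredM.
have dvd_tr a : a \in C -> G %| map_poly tr (a *: F).
  move=> Ca; have CaF: a *: F \is a polyOver C by rewrite polyOverZ.
  have [||T DT] := @integral_poly_in1 (map_poly tr (a *: F)).
  - apply/polyOverP=> i; rewrite coef_map /=.
    by apply: rpred_sum => x _; apply/integral_elt_gal/(polyOverP CaF).
  - by apply/polyOverP=> i; rewrite coef_map; apply: mem_galTrace L_galois (memvf _).
  (* Divisibility descends to [{fraction R}]. Where [f(k) = c g(k)] with [c] integral,
     [F(k) = c G(k)], and since [G(k)] is in the base field the trace of [a F] at [k] is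
     [tr (a * c)] times [G(k)]. *)
  rewrite DT DG0 !map_poly_comp dvdp_map; apply: R_Dring => //.
  apply: sub_finite_set fin_fg => k /= nd [c Cc fk]; apply: nd.
  have [r Dr] := integral_trace (rpredM Ca Cc).
  exists r; apply: frac_ext_embed_inj.
  rewrite rmorphM -!horner_map -DT -DG0 -Dr horner_galTrace hornerZ hornerM fk.
  by rewrite -mulrA -hornerM -DG DG0 horner_map mulrA galTraceMr.
have size_r := ltn_modp F G; rewrite G_nz in size_r.
have tr_r a : a \in C -> map_poly tr (a *: (F %% G)) = 0.
  (* The trace does not raise the degree, so this polynomial is its own remainder modulo [G], and it
     vanishes once [G] divides it. *)
  move=> Ca; rewrite -[LHS](@modp_small _ _ G); last first.
    apply: leq_ltn_trans size_r; rewrite (leq_trans (size_poly _ _)) //.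
    exact: size_scale_leq.
  apply/modp_eq0P; have ->: F %% G = F - F %/ G * G.
    by rewrite {2}(divp_eq F G) addrC addKr.
  rewrite scalerBr raddfB /= dvdp_sub ?dvd_tr // scalerAl.
  by rewrite {3}DG1 map_galTraceM -DG1 dvdp_mull.
apply/modp_eq0P/polyP=> i; rewrite coef0; apply/eqP/negPn/negP => r_nz.
have [a tr_a] := galTrace_neq0 L.
(* The integral element [h s * (a / r_i)], with [r_i] the nonzero coefficient, pairs with [r_i] to
   give the trace [h s * tr a], which is nonzero. *)
have [s s_nz Cs] := frac_ext_integral_multiple (a / (F %% G)`_i).
have /polyP/(_ i) := tr_r _ Cs; rewrite coef_map coefZ coef0 /=.
rewrite -mulrA divfK // mulrC galTraceMr => /eqP; rewrite mulf_eq0 (negPf tr_a) /=.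
by rewrite scaler_eq0 tofrac_eq0 (negPf s_nz) oner_eq0.
Qed.

End IntegralClosureInGalois.

Theorem proposition1p4 (R : idomainType) (L : splittingFieldType {fraction R})
    (R_closed : integrally_closed R)
    (L_galois : galois 1%AS {:L})
    (R_Dring : D_ring R) :
  D_ring (integral_closure (frac_ext_embed L)).
Proof.
set h := frac_ext_embed L; set B := integral_closure h => f g g_nz fin_fg.
pose v : {rmorphism B -> L} := val.
have v_inj : injective v by apply: val_inj.
have Cv (p : {poly B}) : map_poly v p \is a polyOver (integral_elt h).
  by apply/polyOverP=> i; rewrite coef_map; apply: valP.
have vg_nz : map_poly v g != 0 
  by rewrite -(map_poly0 v) (inj_eq (map_inj_poly v_inj (rmorph0 _))).
have h_int r : h r \in integral_elt h by apply/integral_eltP/integral_id.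
pose hB r : B := IntegralElt (h_int r).
have hB_inj : injective hB.
  by move=> r s /(congr1 val)/frac_ext_embed_inj.
have /dvdpP[q Dq] : map_poly v g %| map_poly v f.
  apply: (dvdp_of_integral_quotients R_closed L_galois R_Dring) => //.
  (* Injectivity of [hB] keeps the exceptional set finite when it is restricted to the points coming
     from [R]. *)
  apply: sub_finite_set (finite_preimage (in2W hB_inj) fin_fg) => k nd [c Dc].
  apply: nd; exists (v c); first exact: valP.
  have hv : frac_ext_embed L k = v (hB k) by [].
  by rewrite hv !horner_map Dc rmorphM.
(* The quotient [q] lives in [L[X]], while the goal is over the fraction field of [B]. Scaling [q]
   into [B[X]] gives [s f = q' g] there, and the nonzero scalar [s] is invertible in that field. *)
have [||s s_nz Cs] := @common_multiplier R L h
  (fun x => x \in integral_elt h) _ _ (@frac_ext_integral_multiple R L) q.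
- exact: rpred0.
- by move=> r x; apply: rpredM.
have [|q' Dq'] := @poly_image B L v (h s *: q).
  by move=> i; exists (IntegralElt (Cs i)).
have {}Dq : hB s *: f = q' * g.
  apply: (map_inj_poly v_inj (rmorph0 _)).
  by rewrite map_polyZ Dq scalerAl rmorphM /= -Dq'.
have nz : tofrac (hB s) != 0.
  by rewrite tofrac_eq0 -(inj_eq v_inj) rmorph0 -(rmorph0 h)
    (inj_eq (@frac_ext_embed_inj _ _)).
by rewrite -(dvdpZr _ _ nz) -map_polyZ Dq rmorphM dvdp_mull.
Qed.
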